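(* Let $\bar\zeta:\mathbb{R}^{n+m}\times\mathbb{R}^{n+m}\to\mathbb{R}^{n+m}$ be a differentiable map with $\bar\zeta(\zeta,\zeta)=\zeta$ for all $\zeta$, let $\bar\nabla\mathcal{H}$ be a discrete gradient of the Hamiltonian $\mathcal{H}:\mathcal{D}^*\cong\mathbb{R}^{n+m}\to\mathbb{R}$ of the nonholonomic system, and let $h\neq 0$. Suppose that $\zeta=(q,\rho)$ and $\zeta'=(q',\rho')$ in $\mathcal{D}^*\cong\mathbb{R}^{n+m}$ satisfy the discrete gradient method $$\frac{\zeta'-\zeta}{h}=\Pi\big(\bar\zeta(\zeta,\zeta')\big)\,\bar\nabla\mathcal{H}(\zeta,\zeta').$$ Write $\bar q\in\mathbb{R}^n$ for the $q$-component of $\bar\zeta(\zeta,\zeta')$. Then the discretized nonholonomic constraints $$\sum_{j=1}^n\mu^\alpha_j(\bar q)\,\frac{q'^j-q^j}{h}=0,\qquad m+1\le\alpha\le n,$$ hold.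
   Context: Nonholonomic system. The configuration space is $Q=\mathbb{R}^n$ with coordinates $q=(q^1,\dots,q^n)$, $g$ is a Riemannian metric on $Q$, $V:Q\to\mathbb{R}$ is a potential function, and the Lagrangian is $L(v_q)=\frac12 g(v_q,v_q)-V(q)$. The linear velocity constraints are given by a smooth distribution $\mathcal{D}\subset TQ$ of constant rank $m\le n$. Its annihilator $\mathcal{D}^\circ$ is spanned by linearly independent 1-forms $\mu^\alpha=\sum_i\mu^\alpha_i(q)\,dq^i$, $m+1\le\alpha\le n$, so the constraints on velocities are $\sum_i\mu^\alpha_i(q)\dot q^i=0$. Adapted frame. $\{X_a,X_\alpha\}$, $1\le a\le m$, $m+1\le\alpha\le n$, is a frame of vector fields on $Q$ such that $\mathcal{D}_q=\mathrm{span}\{X_a(q)\}$ and the $g$-orthogonal complement of $\mathcal{D}_q$ is $\mathrm{span}\{X_\alpha(q)\}$. Write $X_a=\sum_i X_a^i\,\partial/\partial q^i$. The functions $C_{ab}^c$ and $C_{ab}^\alpha$ on $Q$ are defined by $[X_a,X_b]=\sum_c C_{ab}^cX_c+\sum_\alpha C_{ab}^\alpha X_\alpha$ for $1\le a,b\le m$. Set $g_{ab}=g(X_a,X_b)$ and let $(g^{ab})$ be the inverse matrix of $(g_{ab})_{1\le a,b\le m}$. Hamiltonian form. The dual bundle $\mathcal{D}^*$ is identified with $\mathbb{R}^{n+m}$ through the coordinates $\zeta=(q^i,\rho_a)$, $1\le i\le n$, $1\le a\le m$, where $\rho_a$ are the fibre coordinates dual to the frame $\{X_a\}$ of $\mathcal{D}$.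 The Hamiltonian is $\mathcal{H}(q,\rho)=\frac12\sum_{a,b}g^{ab}(q)\rho_a\rho_b+V(q)$. The skew-symmetric matrix $\Pi$ is $$\Pi(q,\rho)=\begin{pmatrix}0_{n\times n}&\big(X_b^i(q)\big)_{i,b}\\ -\big(X_a^j(q)\big)_{a,j}&\big(-\sum_cC_{ab}^c(q)\rho_c\big)_{a,b}\end{pmatrix},$$ where the upper right block is the $n\times m$ matrix whose $b$-th column is $X_b$, the lower left block is minus its transpose, and the lower right block is $m\times m$. The nonholonomic equations of motion are $\dot\zeta=\Pi(\zeta)\nabla\mathcal{H}(\zeta)$. Discrete gradient. For a differentiable function $H:\mathbb{R}^N\to\mathbb{R}$, a discrete gradient of $H$ is a continuous map $\bar\nabla H:\mathbb{R}^{2N}\to\mathbb{R}^N$ such that $\bar\nabla H(x,x')^T(x'-x)=H(x')-H(x)$ for all $x,x'\in\mathbb{R}^N$ and $\bar\nabla H(x,x)=\nabla H(x)$ for all $x\in\mathbb{R}^N$. Here $N=n+m$. *)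

(* Defs.v *)
From HB Require Import structures.
From mathcomp Require Export all_boot all_order all_algebra.
From mathcomp Require Export all_classical all_reals all_analysis.

Set Implicit Arguments.
Unset Strict Implicit.
Unset Printing Implicit Defensive.

Import Order.TTheory GRing.Theory Num.Theory.
Export numFieldNormedType.Exports.

Local Open Scope classical_set_scope.
Local Open Scope ring_scope.

(* The configuration space Q = R^n is 'cV[R]_n; by the global coordinates its
   tangent vectors are columns 'cV[R]_n and its covectors are rows 'rV[R]_n,
   so that the covector w evaluates on the vector v as w *m v. *)

Section Smooth.
Variables (R : realType) (n : nat) (W : normedModType R).

(* meant for open U, where 'D_v f at points of U only depends on f on U *)
Fixpoint Ck_on (k : nat) (U : set 'cV[R]_n) (f : 'cV[R]_n -> W) : Prop :=
  match k with
  | 0%N => forall q, U q -> {for q, continuous f}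
  | k'.+1 => (forall q, U q -> differentiable f q) /\
             (forall v, Ck_on k' U (fun q => 'D_v f q))
  end.

Definition smooth_on (U : set 'cV[R]_n) (f : 'cV[R]_n -> W) : Prop :=
  forall k, Ck_on k U f.

Definition smooth (f : 'cV[R]_n -> W) : Prop := smooth_on setT f.

End Smooth.

Section NonholonomicSystem.
Variables (R : realType) (n m : nat).

Implicit Types (q u v : 'cV[R]_n) (g : 'cV[R]_n -> 'M[R]_n)
  (D : 'cV[R]_n -> {vspace 'cV[R]_n}).

Definition inner g q u v : R := (u^T *m g q *m v) 0 0.

(* g is given by its matrix of coefficients in the coordinates of Q *)
Record riemannian_metric g : Prop := RiemannianMetric {
  metric_smooth : smooth g;
  metric_sym : forall q u v, inner g q u v = inner g q v u;
  metric_pos : forall q v, v != 0 -> 0 < inner g q v v }.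

(* D q is the fibre of the distribution at q *)
Record smooth_distribution D : Prop := SmoothDistribution {
  distribution_rank : forall q, \dim (D q) = m;
  distribution_smooth : forall q0, exists (U : set 'cV[R]_n)
      (E : 'I_m -> 'cV[R]_n -> 'cV[R]_n),
    [/\ open U, U q0, forall a, smooth_on U (E a) &
        forall q, U q -> <<[tuple E a q | a < m]>>%VS = D q] }.

Definition annihilator (U : {vspace 'cV[R]_n}) : set 'rV[R]_n :=
  [set w | forall v, v \in U -> w *m v = 0].

Definition orthogonal g q (U : {vspace 'cV[R]_n}) : set 'cV[R]_n :=
  [set u | forall v, v \in U -> inner g q u v = 0].

(* In all that follows, al : 'I_(n - m) stands for the index m + 1 + al,
   which ranges over m + 1, ..., n. *)
Record constraint_forms D (mu : 'I_(n - m) -> 'cV[R]_n -> 'rV[R]_n) : Prop :=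
  ConstraintForms {
  forms_smooth : forall al, smooth (mu al);
  forms_free : forall q, free [tuple mu al q | al < n - m];
  forms_span : forall q,
    [set` <<[tuple mu al q | al < n - m]>>%VS] = annihilator (D q) }.

Record adapted_frame g D (X : 'I_m -> 'cV[R]_n -> 'cV[R]_n)
    (Xperp : 'I_(n - m) -> 'cV[R]_n -> 'cV[R]_n) : Prop := AdaptedFrame {
  frame_smooth : forall a, smooth (X a);
  frame_perp_smooth : forall al, smooth (Xperp al);
  frame_basis : forall q,
    basis_of fullv ([tuple X a q | a < m] ++ [tuple Xperp al q | al < n - m]);
  frame_span : forall q, <<[tuple X a q | a < m]>>%VS = D q;
  frame_perp_span : forall q,
    [set` <<[tuple Xperp al q | al < n - m]>>%VS] = orthogonal g q (D q) }.

(* [X, Y]^i = sum_j (X^j d_j Y^i - Y^j d_j X^i) *)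
Definition lie_bracket (X Y : 'cV[R]_n -> 'cV[R]_n) q : 'cV[R]_n :=
  'D_(X q) Y q - 'D_(Y q) X q.

Definition structure_functions (X : 'I_m -> 'cV[R]_n -> 'cV[R]_n)
    (Xperp : 'I_(n - m) -> 'cV[R]_n -> 'cV[R]_n)
    (C : 'I_m -> 'I_m -> 'I_m -> 'cV[R]_n -> R)
    (Cperp : 'I_m -> 'I_m -> 'I_(n - m) -> 'cV[R]_n -> R) : Prop :=
  forall a b q, lie_bracket (X a) (X b) q =
    \sum_c C a b c q *: X c q + \sum_al Cperp a b al q *: Xperp al q.

Definition gram g (X : 'I_m -> 'cV[R]_n -> 'cV[R]_n) q : 'M[R]_m :=
  \matrix_(a, b) inner g q (X a q) (X b q).

(* A point of D^* = R^(n + m) is the column zeta = col_mx q rho, with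
   q = usubmx zeta and rho = dsubmx zeta. *)
Definition hamiltonian g (V : 'cV[R]_n -> R)
    (X : 'I_m -> 'cV[R]_n -> 'cV[R]_n) (zeta : 'cV[R]_(n + m)) : R :=
  let q := usubmx zeta in
  let rho := dsubmx zeta in
  2^-1 * (\sum_a \sum_b invmx (gram g X q) a b * rho a 0 * rho b 0) + V q.

Definition frame_mx (X : 'I_m -> 'cV[R]_n -> 'cV[R]_n) q : 'M[R]_(n, m) :=
  \matrix_(i, b) X b q i 0.

Definition Pi_mx (X : 'I_m -> 'cV[R]_n -> 'cV[R]_n)
    (C : 'I_m -> 'I_m -> 'I_m -> 'cV[R]_n -> R)
    (zeta : 'cV[R]_(n + m)) : 'M[R]_(n + m) :=
  let q := usubmx zeta in
  let rho := dsubmx zeta in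
  block_mx 0 (frame_mx X q)
    (- (frame_mx X q)^T) (\matrix_(a, b) - (\sum_c C a b c q * rho c 0)).

End NonholonomicSystem.

Section DiscreteGradient.
Variables (R : realType) (N : nat).

Definition gradient (H : 'cV[R]_N -> R) (x : 'cV[R]_N) : 'cV[R]_N :=
  \col_i 'D_(delta_mx i 0) H x.

Record discrete_gradient (H : 'cV[R]_N -> R)
    (dH : 'cV[R]_N * 'cV[R]_N -> 'cV[R]_N) : Prop := DiscreteGradient {
  dgrad_differentiable : forall x, differentiable H x;
  dgrad_continuous : continuous dH;
  dgrad_mean_value : forall x x',
    ((dH (x, x'))^T *m (x' - x)) 0 0 = H x' - H x;
  dgrad_diag : forall x, dH (x, x) = gradient H x }.

End DiscreteGradient.

(* Main.v *)
(* The q-component of Pi(zeta) w is a linear combination of the frame X_a(q), so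
   the method forces (q' - q) / h to lie in the distribution at qbar, where the
   mu^alpha vanish. *)
Require Import Defs.

Import GRing.Theory.

Local Open Scope classical_set_scope.
Local Open Scope ring_scope.

(** The upper blocks of [Pi_mx] are zero and the frame matrix, so the discrete velocity is that
    matrix at [qbar] times the momentum part of the discrete gradient ([usubmx_Pi_mul]). The
    constraints are evaluated at the same [qbar], where each [mu al] annihilates every column of the
    frame ([constraint_mul_frame]); associativity of the product concludes. *)

Lemma usubmx_Pi_mul {R : realType} {n m : nat}
    (X : 'I_m -> 'cV[R]_n -> 'cV[R]_n)
    (C : 'I_m -> 'I_m -> 'I_m -> 'cV[R]_n -> R) (zeta w : 'cV[R]_(n + m)) :
  usubmx (Pi_mx X C zeta *m w) = frame_mx X (usubmx zeta) *m dsubmx w.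
Proof.
by rewrite -{1}(vsubmxK w) /Pi_mx mul_block_col col_mxKu mul0mx add0r.
Qed.

(** The columns are the vectors [X b q], which lie in [D q] by [frame_span], while [forms_span] puts
    [mu al q] in the annihilator of [D q]. *)
Lemma constraint_mul_frame {R : realType} {n m : nat}
    {g : 'cV[R]_n -> 'M[R]_n} {D : 'cV[R]_n -> {vspace 'cV[R]_n}}
    {mu : 'I_(n - m) -> 'cV[R]_n -> 'rV[R]_n}
    {X : 'I_m -> 'cV[R]_n -> 'cV[R]_n}
    {Xperp : 'I_(n - m) -> 'cV[R]_n -> 'cV[R]_n}
    (Dmu : constraint_forms D mu) (DX : adapted_frame g D X Xperp)
    (q : 'cV[R]_n) (al : 'I_(n - m)) :
  mu al q *m frame_mx X q = 0.
Proof.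
have mu_ann : annihilator (D q) (mu al q).
  by rewrite -(forms_span Dmu q) /=; apply/memv_span/mapP; exists al;
    rewrite ?mem_enum.
apply/rowP => b; have Xb_D : X b q \in D q.
  by rewrite -(frame_span DX q); apply/memv_span/mapP; exists b;
    rewrite ?mem_enum.
have /rowP/(_ 0) := mu_ann _ Xb_D; rewrite !mxE => mu_Xb.
by rewrite -[RHS]mu_Xb; apply: eq_bigr => j _; rewrite mxE.
Qed.

Theorem mainTheorem1 (R : realType) (n m : nat) (le_mn : (m <= n)%N)
    (g : 'cV[R]_n -> 'M[R]_n) (V : 'cV[R]_n -> R)
    (D : 'cV[R]_n -> {vspace 'cV[R]_n})
    (mu : 'I_(n - m) -> 'cV[R]_n -> 'rV[R]_n)
    (X : 'I_m -> 'cV[R]_n -> 'cV[R]_n)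
    (Xperp : 'I_(n - m) -> 'cV[R]_n -> 'cV[R]_n)
    (C : 'I_m -> 'I_m -> 'I_m -> 'cV[R]_n -> R)
    (Cperp : 'I_m -> 'I_m -> 'I_(n - m) -> 'cV[R]_n -> R)
    (zbar : 'cV[R]_(n + m) * 'cV[R]_(n + m) -> 'cV[R]_(n + m))
    (dH : 'cV[R]_(n + m) * 'cV[R]_(n + m) -> 'cV[R]_(n + m))
    (h : R) (q q' : 'cV[R]_n) (rho rho' : 'cV[R]_m) :
  riemannian_metric g ->
  smooth_distribution m D ->
  constraint_forms D mu ->
  adapted_frame g D X Xperp ->
  structure_functions X Xperp C Cperp ->
  (forall p, differentiable zbar p) ->
  (forall z, zbar (z, z) = z) ->
  discrete_gradient (hamiltonian g V X) dH ->
  h != 0 ->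
  let zeta := col_mx q rho in
  let zeta' := col_mx q' rho' in
  h^-1 *: (zeta' - zeta)
    = Pi_mx X C (zbar (zeta, zeta')) *m dH (zeta, zeta') ->
  let qbar := usubmx (zbar (zeta, zeta')) in
  forall al : 'I_(n - m),
    \sum_(j < n) mu al qbar 0 j * ((q' j 0 - q j 0) / h) = 0.
Proof.
move=> _ _ Dmu DX _ _ _ _ _ zeta zeta' step qbar al.
have velocity : h^-1 *: (q' - q) = frame_mx X qbar *m dsubmx (dH (zeta, zeta')).
  by rewrite -(usubmx_Pi_mul X C) -step /zeta /zeta' opp_col_mx add_col_mx
    scale_col_mx col_mxKu.
(* The pairing is a 1 x 1 matrix; its only entry is the sum in the goal, up to the order of the
   factor [h^-1]. *)
have /rowP/(_ 0) : mu al qbar *m (h^-1 *: (q' - q)) = 0.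
  by rewrite velocity mulmxA (constraint_mul_frame Dmu DX) mul0mx.
rewrite !mxE => mu_velocity; rewrite -[RHS]mu_velocity.
by apply: eq_bigr => j _; rewrite !mxE [h^-1 * _]mulrC.
Qed.
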